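(* Let $\tau$ be a regular tree set, let $\mathcal O'=\mathcal O'(\tau)$ be the set of its directed consistent orientations, and for $\vec s\in\tau$ let $\mathcal O'_{\vec s}=\{O\in\mathcal O':\vec s\in O\}$. Consider the map $f':\vec s\mapsto(\mathcal O'_{\overleftarrow s},\mathcal O'_{\vec s})$ from $\tau$ to the set $\vec{\mathcal N}'(\tau):=f'(\tau)$ of bipartitions of $\mathcal O'$. Then $f'$ is an isomorphism of tree sets if and only if it is injective, which holds if and only if $\tau$ branches everywhere.
   Context: A separation system $(\vec S,\le,{}^* )$ is a poset with an order-reversing involution; write $\overleftarrow s=\vec s^{\,*}$, $s=\{\vec s,\overleftarrow s\}$. $\vec s$ is degenerate if $\vec s=\overleftarrow s$, small if $\vec s\le\overleftarrow s$, trivial if there is a separation $t$ with $\vec s<\vec t$ and $\vec s<\overleftarrow t$. Regular: no small elements; essential: no trivial and no degenerate elements; nested: any two separations have comparable orientations. A tree set is a nested essential separation system; an isomorphism of tree sets is an order isomorphism commuting with the involutions. An orientation contains exactly one of $\vec s,\overleftarrow s$ for each separation $s$; it is consistent if there are no distinct separations $r\ne s$ with orientations $\vec r<\vec s$ and $\overleftarrow r,\vec s$ both in it. A consistent orientation $O$ is directed if for all $\vec r,\vec s\in O$ there is $\vec t\in O$ with $\vec r,\vec s\le\vec t$. A star is a set $\sigma$ of nondegenerate oriented separations with $\vec r\le\overleftarrow s$ for all distinct $\vec r,\vec s\in\sigma$; it is proper if for all distinct $\vec r,\vec s\in\sigma$ we have $\vec r\le\overleftarrow s$ but $\vec r\not\le\vec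 s$, $\vec r\not\ge\vec s$, $\vec r\not\ge\overleftarrow s$. $\tau$ branches everywhere if it contains no proper star of order 2 that is maximal under inclusion among the proper stars contained in $\tau$. Bipartitions $(A,B)$ of a set (disjoint nonempty parts with union the set) form a separation system ordered by $(A,B)\le(C,D)\iff A\subseteq C$, with involution $(A,B)\mapsto(B,A)$. *)

(* Defs.v *)
From HB Require Import structures.
From mathcomp Require Import all_boot all_order.
From mathcomp Require Import mathcomp_extra boolp classical_sets functions.
From mathcomp Require Import cardinality.

Set Implicit Arguments.
Unset Strict Implicit.
Unset Printing Implicit Defensive.

Import Order.TTheory.
Local Open Scope order_scope.
Local Open Scope classical_set_scope.

(* The elements of a separation system are its oriented separations. Requiring
   a porderType (choice operator, boolean order) is no restriction under the
   classical axioms of boolp. *)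
HB.mixin Record POrder_isSepSystem d T of Order.POrder d T := {
  sinv : T -> T;
  sinvK : involutive sinv;
  sinv_anti : forall r s : T, r <= s -> sinv s <= sinv r
}.

#[short(type="sepSystemType")]
HB.structure Definition SepSystem d :=
  { T of POrder_isSepSystem d T & Order.POrder d T }.

Arguments sinv_anti {d T} [r s] : rename.

Section SeparationSystems.
Context d (T : sepSystemType d).
Implicit Types (r s t : T) (sigma : set T).

Definition unoriented s : set T := [set s; sinv s].

Definition degenerate s : Prop := s = sinv s.
Definition small s : Prop := s <= sinv s.
Definition trivial s : Prop := exists t, s < t /\ s < sinv t.

Definition regular : Prop := forall s, ~ small s.
Definition essential : Prop := forall s, ~ trivial s /\ ~ degenerate s.
Definition nested : Prop := forall r s,
  exists r' s', [/\ unoriented r r', unoriented s s' & r' >=< s'].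

Definition orientation (O : set T) : Prop :=
  forall s, exists! s', (O `&` unoriented s) s'.

Definition consistent (O : set T) : Prop :=
  ~ exists r s, [/\ unoriented r <> unoriented s, r < s, O (sinv r) & O s].

Definition directed (O : set T) : Prop :=
  forall r s, O r -> O s -> exists t, [/\ O t, r <= t & s <= t].

Definition star sigma : Prop :=
  (forall s, sigma s -> ~ degenerate s) /\
  (forall r s, sigma r -> sigma s -> r <> s -> r <= sinv s).

Definition proper_star sigma : Prop :=
  star sigma /\
  forall r s, sigma r -> sigma s -> r <> s ->
    [/\ r <= sinv s, ~ (r <= s), ~ (s <= r) & ~ (sinv s <= r)].

Definition maximal_proper_star sigma : Prop :=
  proper_star sigma /\
  forall sigma', proper_star sigma' -> sigma `<=` sigma' -> sigma' = sigma.

Definition branches_everywhere : Prop :=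
  ~ exists sigma, maximal_proper_star sigma /\ (sigma #= `I_2)%card.

End SeparationSystems.

Arguments regular {d} T.
Arguments essential {d} T.
Arguments nested {d} T.
Arguments branches_everywhere {d} T.

HB.mixin Record SepSystem_isTreeSet d T of SepSystem d T := {
  nestedT : nested T;
  essentialT : essential T
}.

#[short(type="treeSetType")]
HB.structure Definition TreeSet d :=
  { T of SepSystem_isTreeSet d T & SepSystem d T }.

HB.mixin Record SepSystem_isRegular d T of SepSystem d T := {
  regularT : regular T
}.

#[short(type="regTreeSetType")]
HB.structure Definition RegTreeSet d :=
  { T of SepSystem_isRegular d T & TreeSet d T }.

Definition tree_set_isomorphism d1 (T1 : treeSetType d1) d2 (T2 : treeSetType d2)
    (f : T1 -> T2) : Prop :=
  [/\ bijective f, {mono f : r s / r <= s} & {morph f : s / sinv s}].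

Definition is_bipartition (U : Type) (X : set U) (p : set U * set U) : Prop :=
  [/\ p.1 `&` p.2 = set0, p.1 `|` p.2 = X, p.1 !=set0 & p.2 !=set0].

Record bipartition (U : Type) (X : set U) := Bipartition {
  bip_parts : set U * set U;
  _ : `[< is_bipartition X bip_parts >]
}.

HB.instance Definition _ (U : Type) (X : set U) := [isSub for @bip_parts U X].
HB.instance Definition _ (U : Type) (X : set U) :=
  [Choice of bipartition X by <:].

Fact bipartition_display : Order.disp_t. Proof. exact: Order.Disp tt tt. Qed.

Section Bipartitions.
Context (U : Type) (X : set U).
Implicit Types p q : bipartition X.

Definition bip_le p q : bool := `[< (val p).1 `<=` (val q).1 >].

Lemma bipP p : is_bipartition X (val p).
Proof. exact/asboolP/(valP p). Qed.

Lemma bip_leP p q : reflect ((val p).1 `<=` (val q).1) (bip_le p q).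
Proof. exact: asboolP. Qed.

Lemma bip_part2 p : (val p).2 = X `\` (val p).1.
Proof.
have [I0 U12 _ _] := bipP p; apply/seteqP; split=> x /=.
  move=> x2; split; last first.
    by move=> x1; have : ((val p).1 `&` (val p).2) x by []; rewrite I0.
  by have : ((val p).1 `|` (val p).2) x; [right|rewrite U12].
by case; rewrite -[X in X x -> _]U12 => -[].
Qed.

Fact bip_le_refl : reflexive bip_le.
Proof. by move=> p; apply/bip_leP. Qed.

Fact bip_le_anti : antisymmetric bip_le.
Proof.
move=> p q /andP[/bip_leP pq /bip_leP qp]; apply/val_inj.
have e1 : (val p).1 = (val q).1 by apply/seteqP.
have e2 : (val p).2 = (val q).2 by rewrite !bip_part2 e1.
by case: (val p) (val q) e1 e2 => [? ?] [? ?] /= -> ->.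
Qed.

Fact bip_le_trans : transitive bip_le.
Proof.
by move=> q p r /bip_leP pq /bip_leP qr; apply/bip_leP; apply: subset_trans qr.
Qed.

HB.instance Definition _ := Order.Le_isPOrder.Build bipartition_display
  (bipartition X) bip_le_refl bip_le_anti bip_le_trans.

Lemma bip_swap_subproof p : `[< is_bipartition X ((val p).2, (val p).1) >].
Proof.
have [I0 U12 n1 n2] := bipP p.
by apply/asboolP; split=> //=; [rewrite setIC|rewrite setUC].
Qed.

Definition bip_swap p : bipartition X :=
  Sub ((val p).2, (val p).1) (bip_swap_subproof p).

Fact bip_swapK : involutive bip_swap.
Proof. by move=> p; apply/val_inj => /=; case: (val p). Qed.

Fact bip_swap_anti p q : p <= q -> bip_swap q <= bip_swap p.
Proof.
move=> /bip_leP pq; apply/bip_leP => /= x; rewrite !bip_part2 => -[Xx nq].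
by split=> // /pq.
Qed.

HB.instance Definition _ := POrder_isSepSystem.Build bipartition_display
  (bipartition X) bip_swapK bip_swap_anti.

End Bipartitions.

Definition Oprime d (tau : sepSystemType d) : set (set tau) :=
  [set O | [/\ orientation O, consistent O & directed O]].

Arguments Oprime {d} tau.

Definition Oprime_at d (tau : sepSystemType d) (s : tau) : set (set tau) :=
  [set O | Oprime tau O /\ O s].

Section Representation.
Context d (tau : regTreeSetType d).
Implicit Types (r s t : tau) (O : set tau).

Lemma nested_cases r s :
  [\/ r <= s, s <= r, r <= sinv s | sinv s <= r].
Proof.
have inv_le (x y : tau) : sinv x <= y -> sinv y <= x.
  by move=> /sinv_anti; rewrite sinvK.
have le_inv (x y : tau) : x <= sinv y -> y <= sinv x.
  by move=> /sinv_anti; rewrite sinvK.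
have [r' [s' [+ + /orP[]]]] := nestedT r s; rewrite /unoriented /=.
all: move=> [->|->] [->|->] h.
- by apply: Or41.
- by apply: Or43.
- by apply: Or44; apply: inv_le.
- by apply: Or42; have := sinv_anti h; rewrite !sinvK.
- by apply: Or42.
- by apply: Or44.
- by apply: Or43; apply: le_inv.
- by apply: Or41; have := sinv_anti h; rewrite !sinvK.
Qed.

Lemma orientation_mem O s : orientation O -> O s \/ O (sinv s).
Proof.
by move=> /(_ s)[s' [[Os' [s's|s's]] _]]; [left|right]; rewrite -s's.
Qed.

Lemma orientation_notmem O s : orientation O -> O s -> O (sinv s) -> False.
Proof.
move=> /(_ s)[s' [_ s'U]] Os Ois; have [_] := essentialT s; apply.
apply: etrans (s'U (sinv s) (conj Ois (or_intror erefl))).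
by rewrite (s'U s (conj Os (or_introl erefl))).
Qed.

(* A maximal chain above s has as its down-closure a directed consistent
   orientation containing s. *)
Lemma Oprime_at_neq0 s : Oprime_at s !=set0.
Proof.
pose P (C : set tau) :=
  (forall c, C c -> s <= c) /\ total_on C (fun x y => x <= y).
have [F FP Ftot|C [[Cs Ctot] Cmax]] := @Zorn_bigcup tau P.
  split=> [c [X FX Xc]|x y [X FX Xx] [Y FY Yy]]; first by have [+ _] := FP _ FX; exact.
  have [XY|YX] := Ftot _ _ FX FY.
    by have [_] := FP _ FY; apply=> //; exact: XY.
  by have [_] := FP _ FX; apply=> //; exact: YX.
have Cext x : s <= x -> (forall c, C c -> c <= x \/ x <= c) -> C x.
  move=> sx Cx; apply: contrapT => nCx; apply: (Cmax (C `|` [set x])).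
    by split=> [|/(_ x)]; [exact: subsetUl|move=> h; apply/nCx/h; right].
  split=> [c [/Cs//|->//]|y z [Cy|->] [Cz|->]]; last by left.
  - exact: Ctot.
  - exact: Cx.
  - by have [] := Cx z Cz; [right|left].
have Css : C s by apply: Cext => // c /Cs; right.
pose O := [set r | exists2 c, C c & r <= c].
have Oub x y : O x -> O y -> exists t, [/\ O t, x <= t & y <= t].
  move=> [c Cc xc] [e Ce ye]; have [ce|ec] := Ctot _ _ Cc Ce.
    by exists e; split=> //; [exists e|exact: le_trans ce].
  by exists c; split=> //; [exists c|exact: le_trans ec].
have Oboth x : O x -> O (sinv x) -> False.
  move=> Ox Oix; have [t [_ xt ixt]] := Oub _ _ Ox Oix.
  apply: (regularT (sinv t)); rewrite /small sinvK.
  by apply: le_trans xt; have := sinv_anti ixt; rewrite sinvK.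
have Ctop x : (forall c, C c -> c <= x) -> O x.
  by move=> Cx; exists x => //; apply: Cext => [|c /Cx]; [exact: Cx|left].
have Odec x : O x \/ O (sinv x).
  apply: contrapT => /not_orP[nOx nOix].
  have Cx c : C c -> c <= x \/ c <= sinv x.
    move=> Cc; have [cx|xc|cx|xc] := nested_cases c x; [by left| |by right|].
      by case: nOx; exists c.
    by case: nOix; exists c => //; rewrite -[leRHS]sinvK; exact: sinv_anti.
  apply: nOx; apply: (Ctop) => c Cc; apply: contrapT => ncx.
  apply: nOix; apply: Ctop => e Ce.
  have [ex|] := Cx e Ce; last by [].
  have [cx|cix] := Cx c Cc; first by case: ncx.
  have [ce|ec] := Ctot _ _ Cc Ce; last exact: le_trans cix.
  by case: ncx; exact: le_trans ex.
exists O; split; last by exists s.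
split=> [x|[x [y [_ xy Oix [c Cc yc]]]]|].
- have [Ox|Oix] := Odec x.
    exists x; split=> [|z [Oz [//|zx]]]; first by split=> //; left.
    by case: (Oboth x) => //; rewrite -zx.
  exists (sinv x); split=> [|z [Oz [zx|//]]]; first by split=> //; right.
  by case: (Oboth x) => //; rewrite -zx.
- by apply: (Oboth x) => //; exists c => //; exact: le_trans (ltW xy) yc.
- by move=> x y Ox Oy; exact: Oub.
Qed.

Lemma fprime_subproof s :
  `[< is_bipartition (Oprime tau) (Oprime_at (sinv s), Oprime_at s) >].
Proof.
apply/asboolP; split=> /=; try exact: Oprime_at_neq0.
- apply/seteqP; split=> // O [[[oO _ _] Ois] [_ Os]].
  exact: orientation_notmem Os Ois.
- apply/seteqP; split=> [O [|] []//|O OO].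
  by have [oO _ _] := OO; case: (orientation_mem s oO); [right|left].
Qed.

Definition fprime_bip s : bipartition (Oprime tau) :=
  Sub (Oprime_at (sinv s), Oprime_at s) (fprime_subproof s).

Lemma fprime_bip_sinv s : fprime_bip (sinv s) = sinv (fprime_bip s).
Proof. by apply/val_inj; rewrite /= sinvK. Qed.

Record Nprime := NprimeElt {
  Nprime_val : bipartition (Oprime tau);
  _ : Nprime_val \in range fprime_bip
}.

HB.instance Definition _ := [isSub for Nprime_val].
HB.instance Definition _ := [Choice of Nprime by <:].
HB.instance Definition _ :=
  [SubChoice_isSubPOrder of Nprime by <: with bipartition_display].

Lemma Nprime_sinv_subproof (p : Nprime) : sinv (val p) \in range fprime_bip.
Proof.
apply/mem_set; have /set_mem[s _ <-] := valP p.
by exists (sinv s) => //; exact: fprime_bip_sinv.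
Qed.

Definition Nprime_sinv (p : Nprime) : Nprime :=
  Sub (sinv (val p)) (Nprime_sinv_subproof p).

Fact Nprime_sinvK : involutive Nprime_sinv.
Proof. by move=> p; apply/val_inj; rewrite /= sinvK. Qed.

Fact Nprime_sinv_anti (p q : Nprime) : p <= q -> Nprime_sinv q <= Nprime_sinv p.
Proof. by rewrite -!Order.le_val; exact: sinv_anti. Qed.

HB.instance Definition _ := POrder_isSepSystem.Build bipartition_display Nprime
  Nprime_sinvK Nprime_sinv_anti.

Lemma Oprime_at_le r s : r <= s -> Oprime_at s `<=` Oprime_at r.
Proof.
move=> rs O [[oO cO dO] Os]; split=> //; apply: contrapT => nOr.
have Oir : O (sinv r) by case: (orientation_mem r oO).
have nrs : r != s by apply/eqP => e; apply: nOr; rewrite e.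
apply: cO; exists r, s; split=> //; last by rewrite lt_neqAle nrs.
move=> /seteqP[_ /(_ s (or_introl erefl))] [/= sr|sir].
  by move: nrs; rewrite sr eqxx.
by apply: (regularT r); rewrite /small -sir.
Qed.

Lemma fprime_bip_le r s : r <= s -> fprime_bip r <= fprime_bip s.
Proof. by move=> /sinv_anti rs; apply/bip_leP; exact: Oprime_at_le. Qed.

(* No bipartition is small, since its parts are nonempty. *)
Lemma bip_nsmall U (X : set U) (p : bipartition X) : ~ small p.
Proof.
move=> /bip_leP /= p12; have [I0 _ [x p1x] _] := bipP p.
by suff : set0 x by []; rewrite -I0; split=> //; exact: p12.
Qed.

Fact Nprime_nested : nested Nprime.
Proof.
move=> p q; have /set_mem[r _ rp] := valP p; have /set_mem[s _ sq] := valP q.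
have cmp x y (x' y' : tau) : val x = fprime_bip x' -> val y = fprime_bip y' ->
    x' <= y' -> (x : Nprime) >=< y.
  move=> xx' yy' /fprime_bip_le; rewrite -xx' -yy' Order.le_val => xy.
  by rewrite comparable_sym ge_comparable.
have qi : val (sinv q) = fprime_bip (sinv s) by rewrite fprime_bip_sinv sq.
have [h|h|h|h] := nested_cases r s.
- by exists p, q; split; [left|left|exact: cmp h].
- by exists p, q; split; [left|left|rewrite comparable_sym; exact: cmp h].
- by exists p, (sinv q); split; [left|right|exact: cmp h].
- by exists p, (sinv q); split; [left|right|rewrite comparable_sym; exact: cmp h].
Qed.

Fact Nprime_regular : regular Nprime.
Proof. by move=> p; rewrite /small -Order.le_val; exact: bip_nsmall. Qed.

Fact Nprime_essential : essential Nprime.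
Proof.
move=> p; split=> [[q [pq piq]]|e]; apply: (@Nprime_regular p); rewrite /small.
  apply: le_trans (ltW pq) _; have := sinv_anti (ltW piq).
  by rewrite sinvK.
by rewrite -e.
Qed.

HB.instance Definition _ := SepSystem_isTreeSet.Build bipartition_display Nprime
  Nprime_nested Nprime_essential.
HB.instance Definition _ :=
  SepSystem_isRegular.Build bipartition_display Nprime Nprime_regular.

Definition fprime s : Nprime := Sub (fprime_bip s) (mem_set (imageT fprime_bip s)).

End Representation.

Arguments fprime {d} tau s.

(* Main.v *)
(* A directed orientation contains both [r] and [s] exactly when it contains an
   upper bound of the two, and if [r < sinv s] such an upper bound is strict by
   regularity. Since every [t] lies in some member of [O'], which is down-closed,
   [f'] separates [r] from [sinv s] iff [r] and [s] have a common strict upper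
   bound [t], which says that [sinv t] extends the proper star [{r, s}]. All
   other nested pairs are separated because the sets [Oprime_at s] are nonempty
   and [Oprime_at s], [Oprime_at (sinv s)] are disjoint. *)
Require Import Defs.
From mathcomp Require Import all_boot all_order.
From mathcomp Require Import boolp classical_sets functions cardinality.

Import Order.TTheory.
Local Open Scope order_scope.
Local Open Scope classical_set_scope.

Lemma card_eq2P (T : choiceType) (A : set T) :
  (A #= `I_2)%card <-> exists r s, r <> s /\ A = [set r; s].
Proof.
split=> [/eq_cardSP[r Ar /eq_cardSP[s [As /= sr]]]|[r [s [rs ->]]]].
  rewrite II0 card_eq0 => /eqP A0; exists r, s; split; first by move=> e; apply: sr.
  apply/seteqP; split=> [x Ax|x [->|->]//].
  apply: contrapT => /not_orP[xr xs].
  by suff : set0 x by []; rewrite -A0.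
apply/eq_cardSP; exists r; first by left.
suff -> : [set r; s] `\ r = [set s] by exact: card_set1.
by apply/seteqP; split=> [x [[]]//|x ->]; split; [right|exact/nesym].
Qed.

Section SeparationSystem.
Context {d} {T : sepSystemType d}.
Implicit Types r s t : T.

Lemma sinv_le r s : (sinv r <= sinv s) = (s <= r).
Proof. by apply/idP/idP => /sinv_anti //; rewrite !sinvK. Qed.

Lemma sinv_lt r s : (sinv r < sinv s) = (s < r).
Proof. by rewrite !lt_leAnge !sinv_le. Qed.

Lemma lt_sinv r s : (r < sinv s) = (s < sinv r).
Proof. by rewrite -sinv_lt sinvK. Qed.

Lemma le_sinv r s : (r <= sinv s) = (s <= sinv r).
Proof. by rewrite -sinv_le sinvK. Qed.

End SeparationSystem.

Section RegularTreeSet.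
Context {d} {tau : regTreeSetType d}.
Implicit Types (r s t : tau) (O : set tau).

Lemma lt_sinv_nle r s : r < sinv s -> ~ (r <= s).
Proof.
move=> /ltW rs' rs; apply: (regularT r); rewrite /small.
by apply: (le_trans rs); rewrite le_sinv.
Qed.

(** Strictness of [r < sinv s] encodes [~ (sinv s <= r)]; regularity excludes [r <= s] and [s <= r],
    and essentiality excludes degenerate elements. *)
Lemma proper_star_lt (sigma : set tau) :
  proper_star sigma <->
  forall r s, sigma r -> sigma s -> r <> s -> r < sinv s.
Proof.
split=> [[_ st] r s sr ss rs|st].
  have [rs' _ _ /negP] := st r s sr ss rs.
  by rewrite lt_leAnge rs' => ->.
split; first by split=> [s _|r s sr ss rs]; [have [] := essentialT s|exact/ltW/st].
move=> r s sr ss rs; have rs' := st r s sr ss rs; split.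
- exact: ltW.
- exact: lt_sinv_nle.
- by apply: lt_sinv_nle; rewrite lt_sinv.
- by apply/negP; rewrite lt_geF.
Qed.

Lemma branches_everywhereP :
  branches_everywhere tau <->
  forall r s, r < sinv s -> exists t, r < t /\ s < t.
Proof.
split=> [br r s rs|ub [sigma [[/proper_star_lt st mx] /card_eq2P[r [s [rs sE]]]]]].
  apply: contrapT => nub; apply: br; exists [set r; s].
  have neq : r <> s by move=> e; apply: (lt_sinv_nle r s) => //; rewrite e.
  split; last by apply/card_eq2P; exists r, s.
  split=> [|sigma /proper_star_lt st rsS].
    apply/proper_star_lt => x y [->|->] [->|->] //.
    by rewrite lt_sinv.
  apply/seteqP; split=> // x Sx; apply: contrapT => /not_orP[/nesym xr /nesym xs].
  (* A further member [x] of the proper star puts [sinv x] strictly above both [r] and [s]. *)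
  apply: nub; exists (sinv x); split; apply: st => //; apply: rsS.
    by left.
  by right.
have rs' : r < sinv s by apply: st => //; rewrite sE; [left|right].
have [t [rt s_t]] := ub r s rs'.
(* By maximality, adding [sinv t] adds nothing, so [sinv t] is [r] or [s], which is then small. *)
have : sigma (sinv t).
  rewrite -[sigma](mx (sigma `|` [set sinv t])); [by right| |exact: subsetUl].
  apply/proper_star_lt; rewrite sE => x y.
  move=> [[->|->]|->] [[->|->]|->] //; rewrite ?sinvK ?sinv_lt //.
  by rewrite lt_sinv.
rewrite sE => -[tE|tE].
  by apply: (regularT r); rewrite /small -{2}tE sinvK ltW.
by apply: (regularT s); rewrite /small -{2}tE sinvK ltW.
Qed.

(** The first part of the image of [s] is [Oprime_at (sinv s)]; passing to inverses brings
    [Oprime_at s] there and reverses the inclusion. *)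
Lemma fprime_le r s :
  fprime tau r <= fprime tau s <-> Oprime_at s `<=` Oprime_at r.
Proof.
rewrite -sinv_le -Order.le_val /= -!fprime_bip_sinv.
by split=> [/bip_leP|h]; [|apply/bip_leP]; rewrite /= !sinvK.
Qed.

Lemma Oprime_at_sinv s O : Oprime_at s O -> ~ Oprime_at (sinv s) O.
Proof. by move=> [[oO _ _] Os] [_]; exact: orientation_notmem Os. Qed.

(** In the other two nested cases some orientation would contain both [r] and [sinv r], or both [s]
    and [sinv s]. *)
Lemma Oprime_at_sub_cmp r s : Oprime_at s `<=` Oprime_at r -> r <= s \/ s <= r.
Proof.
move=> sub; have [h|h|h|h] := nested_cases r s; [by left|by right| |].
  have [O Oir] := Oprime_at_neq0 (sinv r).
  have Os : Oprime_at s O by apply: Oprime_at_le Oir; rewrite -le_sinv.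
  by case: (Oprime_at_sinv _ _ (sub _ Os)).
have [O Os] := Oprime_at_neq0 s.
by case: (Oprime_at_sinv _ _ Os); apply: (Oprime_at_le h); exact: sub.
Qed.

Lemma fprime_inj_mono : injective (fprime tau) ->
  {mono fprime tau : r s / r <= s}.
Proof.
move=> inj r s; apply/idP/idP => [le_f|/Oprime_at_le/fprime_le //].
have [//|sr] := Oprime_at_sub_cmp _ _ (iffLR (fprime_le r s) le_f).
(* If [s <= r], the images are ordered both ways, hence equal. *)
suff -> : r = s by [].
apply/inj/le_anti; rewrite le_f; exact/fprime_le/Oprime_at_le.
Qed.

(** Surjectivity is built into [Nprime], the range of [fprime_bip]. *)
Lemma fprime_bij : injective (fprime tau) -> bijective (fprime tau).
Proof.
move=> inj; rewrite -setTT_bijective; split=> [//|r s _ _|p _]; first exact: inj.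
by have /set_mem[s _ sp] := valP p; exists s => //; exact/val_inj.
Qed.

Lemma fprime_sinv : {morph fprime tau : s / sinv s}.
Proof. by move=> s; apply/val_inj; exact: fprime_bip_sinv. Qed.

Lemma Oprime_at_ub r s O : Oprime_at r O -> Oprime_at s O ->
  exists t, [/\ Oprime_at t O, r <= t & s <= t].
Proof.
move=> [OO Or] [_ Os]; have [_ _ dO] := OO.
by have [t [Ot rt s_t]] := dO r s Or Os; exists t.
Qed.

Lemma fprime_eq_sinv r s : r < sinv s ->
  (fprime tau r = fprime tau (sinv s) <-> ~ exists t, r < t /\ s < t).
Proof.
move=> rs; split=> [e [t [rt s_t]]|nub].
  have [O Ot] := Oprime_at_neq0 t.
  have Or : Oprime_at r O := Oprime_at_le (ltW rt) Ot.
  have Os : Oprime_at s O := Oprime_at_le (ltW s_t) Ot.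
  apply: (Oprime_at_sinv _ _ Os).
  by apply: (iffLR (fprime_le (sinv s) r)); rewrite ?e.
apply/le_anti/andP; split; apply/fprime_le; first exact/Oprime_at_le/ltW.
move=> O Or; have [OO _] := Or; have [oO _ _] := OO.
split=> //; have [Os|//] := orientation_mem s oO.
have [t [_ rt s_t]] := Oprime_at_ub r s O Or (conj OO Os).
(* If [t] were [r] or [s], then [r] and [s] would be comparable, against [lt_sinv_nle]. *)
case: nub; exists t; split; rewrite lt_neqAle ?rt ?s_t andbT; apply/eqP => e.
  by apply: (lt_sinv_nle s r); rewrite 1?lt_sinv // e.
by apply: (lt_sinv_nle r s); rewrite // e.
Qed.

Lemma fprime_injP : injective (fprime tau) <-> branches_everywhere tau.
Proof.
rewrite branches_everywhereP; split=> [inj r s rs|ub].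
  apply: contrapT => /(fprime_eq_sinv _ _ rs)/inj e.
  by move: rs; rewrite e ltxx.
have neq r s : r < s -> fprime tau r <> fprime tau s.
  rewrite -[s]sinvK => rs /(fprime_eq_sinv _ _ rs).
  by apply; exact: ub.
move=> r s e; apply: contrapT => /eqP rs.
(* Equal images force comparability, which leaves only the strict pairs covered by [neq]. *)
have sub : Oprime_at s `<=` Oprime_at r by apply/fprime_le; rewrite e.
have [le|le] := Oprime_at_sub_cmp _ _ sub.
  by apply: (neq r s) => //; rewrite lt_neqAle rs.
by apply: (neq s r) => //; rewrite lt_neqAle eq_sym rs.
Qed.

End RegularTreeSet.

Theorem theorem5p9 (d : Order.disp_t) (tau : regTreeSetType d) :
  (tree_set_isomorphism (fprime tau) <-> injective (fprime tau)) /\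
  (injective (fprime tau) <-> branches_everywhere tau).
Proof.
split; last exact: fprime_injP.
split=> [[/bij_inj //]|inj]; split.
- exact: fprime_bij.
- exact: fprime_inj_mono.
- exact: fprime_sinv.
Qed.
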